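(* Every projective plane multiwheel is 4-critical.
   Context: All graphs are finite and simple. The wheel $W_m$ ($m\ge 3$) consists of a cycle of length $m$ (the rim) together with a hub joined to every rim vertex by an edge called a spike; it is odd if $m$ is odd, and $w_q$ denotes $W_{2q+1}$. The edge sum modulo two of graphs placed on a common vertex set has as vertices the union of their vertex sets and as edges those edges which belong to an odd number of the graphs. A graph is 4-critical if its chromatic number is 4 and every proper subgraph has chromatic number at most 3. A projective plane multiwheel is a graph constructed as follows. Let $q\ge 1$, $k=2q+1$, let $S_0,\dots,S_{k-1}$ be arbitrary odd wheels (not necessarily of equal order), and let $C$ be a wheel $w_q$ (the central wheel) with hub $z$ and rim cycle $u_0u_1\cdots u_{k-1}$ (indices modulo $k$). In each $S_i$, with hub $h$, choose two consecutive spikes $hr'$ and $hr''$ ($r',r''$ adjacent on the rim) and the rim edge $rr'$ with $r\ne r''$; these three chosen edges form the path $r\,r'\,h\,r''$, whose middle edge is the spike $r'h$. Place the wheels on a common vertex set so that the middle spike of $S_i$ is identified with the edge $u_iu_{i+1}$ of $C$ (in either direction), and so that the remaining two chosen edges are matched in cyclic sequence: for each $i$, the chosen edge of $S_i$ other than the middle spike that is incident with $u_{i+1}$ is identified with the chosen edge of $S_{i+1}$ other than the middle spike that is incident with $u_{i+1}$; call the other end of this common edge $v_{i+1}$. The vertices $z,u_0,\dots,u_{k-1},v_0,\dots,v_{k-1}$ are distinct, and apart from the described identifications the wheels have no vertices in common. The projective plane multiwheel is the edge sum modulo two of $S_0,\dots,S_{k-1}$ and $C$; thus exactly the edges $u_iu_{i+1}$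 and $u_iv_i$ are annihilated. *)

(* Defs.v *)
From mathcomp Require Import all_boot.

Set Implicit Arguments.
Unset Strict Implicit.
Unset Printing Implicit Defensive.

(* Several graphs are placed on one ambient finite type [T], so a graph carries
   its own vertex set; the elements of [T] outside [V G] are not vertices. *)
Record graph (T : finType) := Graph {
  V : {set T};
  E : {set {set T}};
  graphP : [forall e in E, (#|e| == 2) && (e \subset V)]
}.

Section Graphs.

Variable T : finType.
Implicit Types (G H : graph T) (s : seq (graph T)) (R : seq T).

Definition proper_subgraph H G : Prop :=
  [/\ V H \subset V G, E H \subset E G & H <> G].

Definition colorable G (k : nat) : bool :=
  [exists f : {ffun {x : T | x \in V G} -> 'I_k},
     [forall x, [forall y, ([set val x; val y] \in E G) ==> (f x != f y)]]].

Lemma colorable_exists G : exists k, colorable G k.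
Proof.
exists #|{: {x : T | x \in V G}}|; apply/existsP; exists [ffun x => enum_rank x].
apply/forallP=> x; apply/forallP=> y; apply/implyP=> xyE; rewrite !ffunE.
apply: contraTneq xyE => /enum_rank_inj ->; rewrite setUid.
apply: contraT => /negbNE xE.
by have /forall_inP /(_ _ xE) := graphP G; rewrite cards1.
Qed.

Definition chromatic_number G : nat := ex_minn (colorable_exists G).

Definition four_critical G : Prop :=
  chromatic_number G = 4 /\
  forall H, proper_subgraph H G -> chromatic_number H <= 3.

Definition edge_sum_edges s : {set {set T}} :=
  [set e | odd (count (fun G => e \in E G) s)].

Lemma edge_sumP s :
  [forall e in edge_sum_edges s,
     (#|e| == 2) && (e \subset \bigcup_(G <- s) V G)].
Proof.
apply/forall_inP=> e; rewrite inE; elim: s => [|G s IHs] //=.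
rewrite oddD big_cons; have [eG|_] := boolP (e \in E G); last first.
  by move=> /IHs /andP[-> es]; apply: subsetU; rewrite es orbT.
by have /forall_inP /(_ _ eG) /andP[-> eV] := graphP G; rewrite subsetU ?eV.
Qed.

Definition edge_sum s : graph T := Graph (edge_sumP s).

(* A cycle is given by the sequence [R] of its vertices in cyclic order. *)
Definition cycle_edges R : {set {set T}} := [set [set x; next R x] | x in R].

Definition is_wheel (m : nat) (h : T) R G : Prop :=
  [/\ 3 <= m, size R = m, uniq (h :: R), V G = [set x in h :: R]
    & E G = [set [set h; x] | x in R] :|: cycle_edges R].

(* [S] is an odd wheel with hub [h], in which the spikes [h r'], [h r''] and the
   rim edge [r r'] are chosen; they form the path [r r' h r'']. *)
Definition odd_wheel_path (S : graph T) (r r' h r'' : T) : Prop :=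
  exists m R, [/\ odd m, is_wheel m h R S, [set r'; r''] \in cycle_edges R,
    [set r; r'] \in cycle_edges R & r != r''].

(* Indices are taken modulo [k = 2q + 1]: [ordS i] stands for [i + 1 mod k].
   The vertex sets of the wheels are already placed in [T], so an identification
   is an equality of vertices; the two cases for [S i] are the two directions in
   which its middle spike can be identified with [u i -- u (i + 1)]. *)
Definition projective_plane_multiwheel G : Prop :=
  exists (q : nat) (z : T) (u v : 'I_(2 * q).+1 -> T)
         (S : 'I_(2 * q).+1 -> graph T) (C : graph T),
  [/\ 1 <= q
    , uniq (z :: codom u ++ codom v)
    , is_wheel (2 * q).+1 z (codom u) C
    , forall i,
        odd_wheel_path (S i) (v i) (u i) (u (ordS i)) (v (ordS i)) \/
        odd_wheel_path (S i) (v (ordS i)) (u (ordS i)) (u i) (v i)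
    & [/\ forall i, V (S i) :&: V C = [set u i; u (ordS i)]
        , forall i, V (S i) :&: V (S (ordS i)) = [set u (ordS i); v (ordS i)]
        , forall i j, j != i -> j != ordS i -> i != ordS j ->
            [disjoint V (S i) & V (S j)]
        & G = edge_sum (C :: codom S)]].

End Graphs.

(* Main.v *)
Require Import Defs.
From mathcomp Require Import all_boot.

Set Implicit Arguments.
Unset Strict Implicit.
Unset Printing Implicit Defensive.

(** Let S be one of the odd wheels, with chosen path r r' h r''.  Deleting the
    three edges of the path leaves a fan: the hub h joined to the inner vertices
    and to the end r of the rim path that starts at r'' and ends at r, together
    with the pendant edge r' r''.  The number of vertices of that rim path is
    even.  Hence in a 3-coloring of the fan r and r'' differ: if r'' has the
    color of h, this is the edge h r, and otherwise the rim path uses only the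
    two colors other than that of h, so it alternates and its ends differ.
    Conversely every coloring of r, r', h, r'' that separates r from h, r'' from
    r' and r from r'' extends to the fan.  These three conditions form a
    path again and they are symmetric under reversal of r r' h r'', so the two
    ways of identifying the middle spike need no separate treatment
    ([piece_terminals_neq], [piece_coloring]).

    So, as far as 3-colorings are concerned, the multiwheel is the graph with
    edges z u_i, v_i u_(i+1), u_i v_(i+1) and v_i v_(i+1), indices modulo the
    odd number k.

    It has no 3-coloring: let w_i be v_i, unless v_i has the color of z, and u_i
    in that case.  Then w_i never has the color of z, and w_i and w_(i+1) have
    different colors, so that two colors alternate around an odd cycle
    ([multiwheel_not_3colorable]).

    Deleting any edge makes a 3-coloring possible, which is all that is
    needed, because no vertex is isolated ([four_critical_by_edges]).
    - For the edge z u_j, give u_i and v_i the same color c_i, where c is a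
      proper coloring of the odd cycle in which the color of z occurs at j only.
    - For an edge e of the fan in S_j, the fan without e has a coloring in which
      u_j and u_(j+1) both have color 0, and v_j and v_(j+1) are both colored 1,
      or one of them is colored 0 and the other 1 ([piece_minus_edge_coloring]).
      Color z by 1.  In the first case color every u_i by 0, and let the v_i
      alternate between 1 and 2 from j+1 round to j.  In the second case let the
      u_i alternate between 0 and 2 from j+1 round to j, and give v_i the color
      of u_i, except for the one vertex v_j or v_(j+1) of color 1. *)

(** * Colorings and deletion of edges *)

Section Colorings.

Variable T : finType.
Implicit Types (G : graph T) (e : {set T}).

(** The edges are sets, so properness at an edge is the size of its image; this
    avoids naming the end vertices in some order. *)
Definition bichromatic (C : finType) (f : T -> C) e : bool := 1 < #|f @: e|.

Lemma bichromatic_pair (C : finType) (f : T -> C) x y :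
  bichromatic f [set x; y] = (f x != f y).
Proof.
by rewrite /bichromatic imsetU1 imset_set1 cards2; case: (_ != _).
Qed.

Lemma edge_pair G e :
  e \in E G -> exists x y, [/\ x \in V G, y \in V G, x != y & e = [set x; y]].
Proof.
move=> eG; have /forall_inP/(_ _ eG)/andP[/cards2P[x [y [xy ->]]] eV] := graphP G.
exists x, y; split=> //; apply: (subsetP eV); first exact: set21.
exact: set22.
Qed.

(** Colorings of the ambient type are easier to glue than colorings of the
    subtype of vertices; the two agree as soon as there is a color for the
    elements that are not vertices, whence the successor. *)
Lemma colorableP G k :
  reflect (exists f : T -> 'I_k.+1, forall e, e \in E G -> bichromatic f e)
          (colorable G k.+1).
Proof.
apply: (iffP existsP) => [[f fP]|[f fP]].
  exists (fun x => if insub x is Some u then f u else ord0).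
  move=> e eG; have [x [y [xG yG _ de]]] := edge_pair eG.
  rewrite de bichromatic_pair !insubT.
  move/forallP/(_ (Sub x xG))/forallP/(_ (Sub y yG))/implyP: fP.
  by apply; rewrite /= -de.
exists [ffun u => f (val u)]; apply/forallP=> x; apply/forallP=> y.
by apply/implyP=> /fP; rewrite bichromatic_pair !ffunE.
Qed.

Lemma colorable_widen G k n : k <= n -> colorable G k -> colorable G n.
Proof.
move=> kn /existsP[f fP]; apply/existsP.
exists [ffun u => widen_ord kn (f u)]; apply/forallP=> x; apply/forallP=> y.
apply/implyP=> xyG; rewrite !ffunE.
by have /forallP/(_ x)/forallP/(_ y)/implyP/(_ xyG) := fP.
Qed.

Lemma chromatic_number_le G k : (chromatic_number G <= k) = colorable G k.
Proof.
rewrite /chromatic_number; case: ex_minnP => n nG n_min.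
by apply/idP/idP=> [kn|/n_min//]; apply: colorable_widen nG.
Qed.

(** Without isolated vertices the edge set determines the graph. *)
Lemma proper_subgraph_edge H G :
    V G \subset cover (E G) -> proper_subgraph H G ->
  exists2 e, e \in E G & e \notin E H.
Proof.
move=> GV [VHG EHG neqHG]; apply/subsetPn; apply/negP=> EGH; apply: neqHG.
have eqE : E H = E G by apply/eqP; rewrite eqEsubset EHG.
have VGH : V G \subset V H.
  apply: subset_trans GV _; rewrite -eqE; apply/bigcupsP=> e eH.
  by have /forall_inP/(_ _ eH)/andP[] := graphP H.
have eqV : V H = V G by apply/eqP; rewrite eqEsubset VHG.
case: H G eqV eqE {VHG EHG GV EGH VGH} => [VH EH HP] [VG EG GP] /= eqV eqE.
by subst VH EH; congr Graph; apply: bool_irrelevance.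
Qed.

(** A coloring with three colors of the graph without one edge becomes proper on
    the whole graph when one end of that edge receives a fourth color. *)
Lemma four_critical_by_edges G :
    ~~ colorable G 3 ->
    V G \subset cover (E G) ->
    (forall e, e \in E G -> exists f : T -> 'I_3,
       forall e', e' \in E G -> e' != e -> bichromatic f e') ->
  four_critical G.
Proof.
move=> G3 GV Gdel; split=> [|H HG].
  have [e eG] : exists e, e \in E G.
    apply/set0Pn; apply: contraNneq G3 => G0.
    by apply/colorableP; exists (fun=> ord0) => e; rewrite G0 inE.
  have [f fP] := Gdel e eG.
  have [x [y [_ _ _ de]]] := edge_pair eG.
  apply/eqP; rewrite eqn_leq [3 < _]ltnNge !chromatic_number_le G3 andbT.
  apply/colorableP.
  exists (fun t => if t == x then ord_max else widen_ord (leqnSn 3) (f t)).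
  move=> e' e'G; have [a [b [_ _ ab de']]] := edge_pair e'G.
  have wid_max (c : 'I_3) : (widen_ord (leqnSn 3) c == ord_max) = false.
    by apply/negbTE; rewrite -val_eqE /= ltn_eqF.
  rewrite de' bichromatic_pair.
  have [ax | ax] := eqVneq a x.
    by rewrite -ax [b == a]eq_sym (negbTE ab) eq_sym wid_max.
  have [bx | bx] := eqVneq b x; first by rewrite wid_max.
  have fe' : bichromatic f e'.
    apply: fP e'G _; apply: contraTneq (set21 x y) => ee'.
    by rewrite -de -ee' de' in_set2 ![x == _]eq_sym negb_or ax.
  by move: fe'; rewrite de' bichromatic_pair; apply: contra => /eqP[/val_inj->].
have [e eG eH] := proper_subgraph_edge GV HG.
have [f fP] := Gdel e eG; have [_ EHG _] := HG.
rewrite chromatic_number_le; apply/colorableP; exists f => e' e'H.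
by apply: fP; [apply: (subsetP EHG) | apply: contraNneq eH => <-].
Qed.

End Colorings.

(** * Color sequences *)

Section ThreeColors.

Implicit Types a b c x y : 'I_3.

Lemma third_color a b : exists2 c, c != a & c != b.
Proof.
have /set0Pn[c] : ~: [set a; b] != set0.
  by rewrite -card_gt0 cardsCs setCK cards2 card_ord; case: (a != b).
by rewrite !inE negb_or => /andP[]; exists c.
Qed.

Lemma two_remaining_colors c x y a :
  x != c -> y != c -> a != c -> x != y -> (a == y) = (a != x).
Proof.
by move: c x y a; do 4!case=> [[|[|[|?]]] //= ?].
Qed.

End ThreeColors.

Fixpoint alternate (C : Type) (a b : C) n : seq C :=
  if n is n'.+1 then a :: alternate b a n' else [::].

Section Alternate.

Variable C : eqType.
Implicit Types a b c : C.

Lemma size_alternate a b n : size (alternate a b n) = n.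
Proof. by elim: n a b => //= n IHn a b; rewrite IHn. Qed.

Lemma last_alternate a b n : last b (alternate a b n) = if odd n then a else b.
Proof. by elim: n a b => //= n IHn a b; rewrite IHn; case: odd. Qed.

Lemma path_alternate a b n :
  a != b -> path (fun x y => x != y) b (alternate a b n).
Proof.
by elim: n a b => //= n IHn a b ab; rewrite eq_sym ab IHn // eq_sym.
Qed.

Lemma alternate_neq a b c n :
  a != c -> b != c -> all (fun x => x != c) (alternate a b n).
Proof. by elim: n a b => //= n IHn a b ac bc; rewrite ac IHn. Qed.

(** Alternation with a prescribed last color: a rim path that an edge deletion
    has cut off is colored backwards from its end. *)
Lemma alternate_to a b c n : a != b -> a != c -> b != c ->
  exists x xs, [/\ size xs = n, last x xs = a, all (fun y => y != c) (x :: xs)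
                 & path (fun x y => x != y) x xs].
Proof.
move=> ab ac bc; have [n_odd|n_even] := boolP (odd n).
  exists b, (alternate a b n).
  by rewrite size_alternate last_alternate n_odd path_alternate //= bc alternate_neq.
exists a, (alternate b a n); rewrite size_alternate last_alternate (negbTE n_even).
by rewrite path_alternate ?[b == a]eq_sym //= ac alternate_neq.
Qed.

End Alternate.

(** * The fan left by an odd wheel *)

Section Fans.

Variable T : finType.
Implicit Types (S : graph T) (e : {set T}) (x y h r : T) (s R : seq T).

Definition path_edges x s : seq {set T} := pairmap (fun a b => [set a; b]) x s.

Definition fan_edges r' h r'' s : seq {set T} :=
  [set r'; r''] :: [seq [set h; x] | x <- s] ++ path_edges r'' s.

Lemma path_edgesP e x s :
    e \in path_edges x s ->
  exists s1 y s2, s = s1 ++ y :: s2 /\ e = [set last x s1; y].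
Proof.
elim: s x => //= y s IHs x; rewrite inE => /predU1P[->|/IHs[s1 [z [s2 [-> ->]]]]].
  by exists [::], y, s.
by exists (y :: s1), z, s2.
Qed.

Lemma all_path_edges (C : finType) (f : T -> C) x s :
  all (bichromatic f) (path_edges x s) =
  path (fun a b => a != b) (f x) [seq f y | y <- s].
Proof. by elim: s x => //= y s IHs x; rewrite bichromatic_pair IHs. Qed.

Lemma all_fan_edges (C : finType) (f : T -> C) r' h r'' s :
  all (bichromatic f) (fan_edges r' h r'' s) =
  [&& f r' != f r'', all (fun c => c != f h) [seq f y | y <- s]
    & path (fun a b => a != b) (f r'') [seq f y | y <- s]].
Proof.
rewrite /= bichromatic_pair all_cat all_path_edges !all_map.
by congr [&& _, _ & _]; apply: eq_all => x /=; rewrite bichromatic_pair eq_sym.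
Qed.

Lemma seq_coloring (C : Type) (c0 : C) s (cs : seq C) :
  uniq s -> size cs = size s -> exists f : T -> C, [seq f x | x <- s] = cs.
Proof.
elim: s cs => [|x s IHs] [|c cs] //=.
move=> /andP[xs s_uniq] [/(IHs _ s_uniq)[f <-]].
exists (fun y => if y == x then c else f y); rewrite eqxx; congr (_ :: _).
by apply/eq_in_map=> y ys; case: eqVneq => // yx; rewrite -yx ys in xs.
Qed.

(** When r'' does not have the color of the hub, the rim path alternates between
    two colors and has an even number of vertices. *)
Lemma fan_terminals_neq (f : T -> 'I_3) r' h r'' s :
    odd (size s) -> all (bichromatic f) (fan_edges r' h r'' s) ->
  [/\ f (last r'' s) != f h, f r' != f r'' & f (last r'' s) != f r''].
Proof.
rewrite all_fan_edges -(size_map f) -last_map => s_odd /and3P[r'r'' sh sP].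
have lh : last (f r'') [seq f y | y <- s] != f h.
  case: [seq f y | y <- s] s_odd sh {sP} => // c cs _.
  by move/allP/(_ _ (mem_last c cs)).
split=> //; have [r''h|r''h] := eqVneq (f r'') (f h); first by rewrite {2}r''h.
(* All vertices of the rim path avoid the color of the hub, so each step flips
   between the two colors that remain. *)
suff -> : (last (f r'') [seq f y | y <- s] == f r'')
        = ~~ odd (size [seq f y | y <- s]) by rewrite s_odd.
move: (f r'') r''h sh sP {r'r'' s_odd}.
elim: [seq f y | y <- s] => [|d cs IHs] c ch /=; first by rewrite eqxx.
move=> /andP[dh sh] /andP[cd sP]; rewrite -(IHs d) // {IHs}.
apply: (@two_remaining_colors (f h)) => //; last by rewrite eq_sym.
elim: (cs) (d) (dh) (sh) => //= x xs IHxs y yh /andP[xh /IHxs]; exact.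
Qed.

(** The rim path after r'' alternates between a and a color o other than a and
    c; its odd length makes it end in a as well. *)
Lemma fan_coloring (a b c d : 'I_3) r' h r'' s :
    uniq [:: h, r', r'' & s] -> odd (size s) ->
    a != c -> d != b -> a != d ->
  exists f : T -> 'I_3,
    [/\ f (last r'' s) = a, f r' = b, f h = c, f r'' = d
      & all (bichromatic f) (fan_edges r' h r'' s)].
Proof.
move=> s_uniq s_odd ac db ad; have [o oa oc] := third_color a c.
have [|f [fh fr' fr'' fs]] :=
    @seq_coloring _ ord0 _ [:: c, b, d & alternate a o (size s)] s_uniq.
  by rewrite /= size_alternate.
exists f; rewrite all_fan_edges fh fr' fr'' fs [b == d]eq_sym db -last_map fs.
rewrite alternate_neq //=; split=> //.
  by case: (size s) s_odd => //= n; rewrite last_alternate => /negbTE->.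
case: (size s) => //= n; rewrite eq_sym ad; apply: path_alternate.
by rewrite eq_sym; rewrite eq_sym in oa.
Qed.

(** When r' and h both have color a, the intact fan forces the colors b and c,
    in some order, on the ends of its rim path. The missing edge allows other
    colors there: either the alternation of b and c is broken inside the rim
    path, and both ends can have color b, or one end can take color a. *)
Lemma fan_minus_edge_coloring (a b c : 'I_3) r' h r'' s e :
    a != b -> c != a -> c != b ->
    uniq [:: h, r', r'' & s] -> odd (size s) -> e \in fan_edges r' h r'' s ->
  exists f : T -> 'I_3,
    [/\ f r' = a, f h = a,
        (f (last r'' s), f r'') \in [:: (b, b); (a, b); (b, a)]
      & forall e', e' \in fan_edges r' h r'' s -> e' != e -> bichromatic f e'].
Proof.
move=> ab ca cb s_uniq s_odd.
have ba : b != a by rewrite eq_sym.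
have bc : b != c by rewrite eq_sym.
rewrite inE mem_cat => /predU1P[->|/orP[/mapP[x xs ->]|/path_edgesP]].
(* Without r' r'', the vertex r'' can take the color of r'. *)
- have [|f [fh fr' fr'' fs]] :=
      @seq_coloring _ ord0 _ [:: a, a, a & alternate b c (size s)] s_uniq.
    by rewrite /= size_alternate.
  exists f; rewrite -last_map fh fr' fr'' fs; split=> //.
    case: (size s) s_odd => //= n; rewrite last_alternate => /negbTE->.
    by rewrite !inE eqxx !orbT.
  move=> e'; rewrite inE => /predU1P[->|]; first by rewrite eqxx.
  move=> e's _; suff /allP/(_ e' e's) : all (bichromatic f)
      ([seq [set h; x] | x <- s] ++ path_edges r'' s) by [].
  rewrite all_cat all_path_edges fr'' fs; apply/andP; split.
    have /allP sa : all (fun d => d != a) [seq f y | y <- s].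
      by rewrite fs alternate_neq.
    apply/allP=> _ /mapP[x xs ->]; rewrite bichromatic_pair fh eq_sym.
    by apply: sa; apply: map_f.
  by case: (size s) => //= n; rewrite ab path_alternate.
(* Without h x, the vertex x takes the color of h, and the alternation starts
   afresh behind it, unless x is the end of the rim path. *)
- have [s1 [s2 ds]] : exists s1 s2, s = s1 ++ x :: s2.
    by case/splitPr: xs => s1 s2; exists s1, s2.
  have [cs [size_cs last_cs cs_a cs_path]] : exists cs, [/\ size cs = size s2,
      last a cs = (if nilp s2 then a else b), all (fun d => d != a) cs
    & path (fun d d' => d != d') a cs].
    case: (s2) => [|y s3]; first by exists [::].
    have [d [cs [cs_size cs_last cs_a cs_path]]] := alternate_to (size s3) bc ba ca.
    exists (d :: cs); split; rewrite //= ?cs_size // cs_path andbT eq_sym.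
    by have /andP[] := cs_a.
  have [|f [fh fr' fr'' fs]] := @seq_coloring _ ord0 _
      [:: a, a, b & alternate c b (size s1) ++ a :: cs] s_uniq.
    by rewrite /= ds !size_cat size_alternate /= size_cs.
  have [fs1 fx fs2] : [/\ [seq f y | y <- s1] = alternate c b (size s1),
      f x = a & [seq f y | y <- s2] = cs].
    move/eqP: fs; rewrite ds map_cat eqseq_cat ?size_map ?size_alternate //=.
    by case/andP=> /eqP-> /eqP[-> ->].
  exists f; rewrite -last_map fs last_cat /= last_cs fh fr' fr''; split=> //.
    by rewrite !inE; case: ifP; rewrite eqxx ?orbT.
  move=> e'; rewrite inE mem_cat => /predU1P[->|/orP[/mapP[y ys ->]|]].
  + by rewrite bichromatic_pair fr' fr''.
  + rewrite bichromatic_pair fh [a == _]eq_sym => yx.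
    have {}yx : y != x by apply: contraNneq yx => ->.
    move: ys; rewrite ds mem_cat inE (negbTE yx) /= => /orP[ys|ys].
      have s1a := alternate_neq (size s1) ca ba.
      by rewrite -fs1 in s1a; apply: (allP s1a _ (map_f f ys)).
    by rewrite -fs2 in cs_a; apply: (allP cs_a _ (map_f f ys)).
  move=> e's _; suff /allP/(_ e' e's) : all (bichromatic f) (path_edges r'' s) by [].
  rewrite all_path_edges fr'' fs cat_path path_alternate //= last_alternate cs_path.
  by case: odd; rewrite ?ca ?ba.
(* Without a rim edge the alternation starts afresh behind it. *)
- move=> [s1 [y [s2 [ds ->]]]].
  have [d [cs [cs_size cs_last cs_a cs_path]]] := alternate_to (size s2) bc ba ca.
  have [|f [fh fr' fr'' fs]] := @seq_coloring _ ord0 _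
      [:: a, a, b & alternate c b (size s1) ++ d :: cs] s_uniq.
    by rewrite /= ds !size_cat size_alternate /= cs_size.
  have [fs1 fy fs2] : [/\ [seq f x | x <- s1] = alternate c b (size s1),
      f y = d & [seq f x | x <- s2] = cs].
    move/eqP: fs; rewrite ds map_cat eqseq_cat ?size_map ?size_alternate //=.
    by case/andP=> /eqP-> /eqP[-> ->].
  exists f; rewrite -last_map fs last_cat /= cs_last fh fr' fr''; split=> //.
    by rewrite inE eqxx.
  move=> e'; rewrite inE mem_cat => /predU1P[->|/orP[/mapP[x xs ->]|]].
  + by rewrite bichromatic_pair fr' fr''.
  + rewrite bichromatic_pair fh [a == _]eq_sym => _.
    have sa : all (fun d => d != a) [seq f x | x <- s].
      by rewrite fs all_cat alternate_neq.
    exact: (allP sa _ (map_f f xs)).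
  rewrite ds /path_edges pairmap_cat mem_cat /= inE.
  case/or3P=> [e's1 _|/eqP->|e's2 _].
  + suff /allP/(_ e' e's1) : all (bichromatic f) (path_edges r'' s1) by [].
    by rewrite all_path_edges fr'' fs1 path_alternate.
  + by rewrite eqxx.
  suff /allP/(_ e' e's2) : all (bichromatic f) (path_edges y s2) by [].
  by rewrite all_path_edges fy fs2.
Qed.

Definition path4_edges (a b c d : T) : {set {set T}} :=
  [set [set a; b]; [set b; c]; [set c; d]].

Lemma path4_edges_rev a b c d : path4_edges d c b a = path4_edges a b c d.
Proof.
rewrite /path4_edges [[set d; c]]setUC [[set c; b]]setUC [[set b; a]]setUC.
apply/setP=> e; rewrite !inE.
by case: (e == [set a; b]); case: (e == [set b; c]); case: (e == [set c; d]).
Qed.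

Lemma set2_eq a b c d :
  [set a; b] = [set c; d] :> {set T} -> a = c /\ b = d \/ a = d /\ b = c.
Proof.
move=> E.
have /set2P acd : a \in [set c; d] by rewrite -E set21.
have /set2P bcd : b \in [set c; d] by rewrite -E set22.
have /set2P cab : c \in [set a; b] by rewrite E set21.
have /set2P dab : d \in [set a; b] by rewrite E set22.
by case: acd => ?; case: bcd => ?; case: cab => ?; case: dab => ?; subst; auto.
Qed.

Lemma mem_cycle_edges x s :
  uniq (x :: s) -> cycle_edges (x :: s) =i path_edges x (rcons s x).
Proof.
move=> s_uniq e; apply/imsetP/(nthP set0) => [[y ys ->]|[i]].
  exists (index y (x :: s)); first by rewrite size_pairmap size_rcons index_mem.
  rewrite (nth_pairmap x) ?size_rcons ?index_mem // next_nth ys.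
  rewrite -rcons_cons !nth_rcons index_mem ys nth_index //.
  by case: ltnP => // si; rewrite if_same (nth_default x si).
rewrite size_pairmap size_rcons => lt_i <-.
exists (nth x (x :: s) i); first exact: mem_nth.
rewrite (nth_pairmap x) ?size_rcons // next_nth mem_nth // index_uniq //.
rewrite -rcons_cons !nth_rcons lt_i.
by case: ltnP => // si; rewrite if_same (nth_default x si).
Qed.

Lemma cycle_edges_rot n R : uniq R -> cycle_edges (rot n R) = cycle_edges R.
Proof.
move=> R_uniq; apply/setP=> e; apply/imsetP/imsetP=> -[x xR ->]; exists x.
- by rewrite mem_rot in xR.
- by rewrite next_rot.
- by rewrite mem_rot.
- by rewrite next_rot.
Qed.

Lemma cycle_edges_rev R : uniq R -> cycle_edges (rev R) = cycle_edges R.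
Proof.
move=> R_uniq; apply/setP=> e; apply/imsetP/imsetP=> -[x xR ->].
  rewrite mem_rev in xR; exists (prev R x); first by rewrite mem_prev.
  by rewrite next_rev // next_prev // setUC.
exists (next R x); first by rewrite mem_rev mem_next.
by rewrite next_rev // prev_next // setUC.
Qed.

(** A cycle can be read from any of its edges, in either direction. *)
Lemma cycle_from_edge R x y :
    uniq R -> x != y -> [set x; y] \in cycle_edges R ->
  exists s, [/\ R =i [:: x, y & s], size R = (size s).+2,
    uniq [:: x, y & s] & cycle_edges R = cycle_edges [:: x, y & s]].
Proof.
move=> R_uniq xy.
have start R' : uniq R' -> x \in R' -> next R' x = y ->
    exists s, [/\ R' =i [:: x, y & s], size R' = (size s).+2,
      uniq [:: x, y & s] & cycle_edges R' = cycle_edges [:: x, y & s]].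
  move=> R'_uniq xR' next_x; have [i s' ds'] := rot_to xR'.
  have dy : next (x :: s') x = y by rewrite -ds' next_rot.
  case: s' ds' dy => [|y' s] ds' dy; rewrite /= eqxx in dy.
    by rewrite dy eqxx in xy.
  exists s; rewrite -dy -ds' rot_uniq cycle_edges_rot //; split=> //.
    by move=> t; rewrite mem_rot.
  by rewrite -(size_rot i) ds'.
move=> /imsetP[t tR /set2_eq[[dx dy]|[dx dy]]].
  by apply: start; rewrite ?dx // dy.
have [|||s [Rs szs s_uniq Es]] := start (rev R); first by rewrite rev_uniq.
- by rewrite mem_rev dx mem_next.
- by rewrite next_rev // dx prev_next.
exists s; rewrite -(size_rev R) -cycle_edges_rev //; split=> //.
by move=> a; rewrite -Rs mem_rev.
Qed.

(** Reading the rim from r' towards r'' puts r last, because r is the other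
    neighbor of r' on the rim. *)
Lemma odd_wheel_path_fan S r r' h r'' :
    odd_wheel_path S r r' h r'' ->
  exists s, [/\ uniq [:: h, r', r'' & s], odd (size s) /\ last r'' s = r,
    V S = [set x in [:: h, r', r'' & s]], path4_edges r r' h r'' \subset E S
    & E S :\: path4_edges r r' h r'' =i fan_edges r' h r'' s].
Proof.
case=> m [R [m_odd [m3 szR /andP[hR R_uniq] VS ES] r'r'' rr' r_r'']].
have r'_r'' : r' != r''.
  have : [set r'; r''] \in E S by rewrite ES inE r'r'' orbT.
  by have /forall_inP GS := graphP S; move/GS; rewrite cards2; case: (r' != r'').
have [s [Rs szs s_uniq Cs]] := cycle_from_edge R_uniq r'_r'' r'r''.
have CE e : (e \in cycle_edges R) =
    [|| e == [set r'; r''], e \in path_edges r'' s | e == [set r'; last r'' s]].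
  rewrite Cs mem_cycle_edges //= inE /path_edges -cats1 pairmap_cat mem_cat /=.
  by rewrite mem_seq1 [[set r'; last _ _]]setUC.
have hs_uniq : uniq [:: h, r', r'' & s] by rewrite cons_uniq -Rs hR.
have path_sub e : e \in path_edges r'' s -> e \subset r'' :: s.
  move=> /path_edgesP[s1 [y [s2 [-> ->]]]]; apply/subsetP=> t.
  rewrite in_set2 -cat_cons mem_cat => /pred2P[]->; first by rewrite mem_last.
  by rewrite mem_head orbT.
have dr : last r'' s = r.
  move: rr'; rewrite CE => /or3P[/eqP/set2_eq|/path_sub/subsetP|/eqP/set2_eq].
  - by case=> [[dr dr']|[dr _]]; [rewrite dr' eqxx in r'_r''|rewrite dr eqxx in r_r''].
  - move/(_ r' (set22 _ _)) => r's; by have := s_uniq; rewrite cons_uniq r's.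
  case=> [[dr dr']|[-> //]]; have := s_uniq; rewrite cons_uniq dr' mem_last.
  by [].
exists s; split=> //.
- by move: m_odd; rewrite -szR szs /= negbK.
- by rewrite VS; apply/setP=> t; rewrite !inE Rs !inE.
- rewrite ES !subUset !sub1set !in_setU rr' orbT /=.
  rewrite [[set r'; h]]setUC !(imset_f (fun x => [set h; x])) //.
    by rewrite Rs !inE eqxx orbT.
  by rewrite Rs mem_head.
- have spikeE e : (e \in [set [set h; x] | x in R]) =
    [|| e == [set h; r'], e == [set h; r''] | e \in [seq [set h; x] | x <- s]].
  rewrite -[RHS]/(e \in [seq [set h; x] | x <- [:: r', r'' & s]]).
  apply/imsetP/mapP=> -[x xR ->]; exists x => //.
    by rewrite -Rs.
  by rewrite Rs.
have path4E e : (e \in path4_edges r r' h r'') =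
    [|| e == [set r'; r], e == [set h; r'] | e == [set h; r'']].
  by rewrite !inE [[set r; r']]setUC [[set r'; h]]setUC orbA.
move: hs_uniq; rewrite !cons_uniq !inE !negb_or => /and4P[].
case/and3P=> /eqP hr' /eqP hr'' /negP hs /andP[_ /negP r's] /negP r''s _.
have rs : r \in r'' :: s by rewrite -dr mem_last.
have /negP hrs : h \notin r'' :: s.
  by rewrite inE negb_or; apply/andP; split; [apply/eqP | apply/negP].
have /negP r'rs : r' \notin r'' :: s.
  by rewrite inE negb_or r'_r''; apply/negP.
move=> e; rewrite in_setD path4E ES in_setU spikeE CE inE mem_cat dr.
have [fan_e|] := boolP [|| e == [set r'; r''], e \in [seq [set h; x] | x <- s]
   | e \in path_edges r'' s]; last first.
  rewrite !negb_or => /and3P[/negbTE-> /negbTE-> /negbTE->].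
  by case: (e == [set r'; r]); case: (e == [set h; r']); case: (e == [set h; r'']).
(* The edges of the path contain r' and r, or h and one of r', r''; those of the
   fan do not. *)
have eP : ~~ [|| e == [set r'; r], e == [set h; r'] | e == [set h; r'']].
  have P_e : [|| e == [set r'; r], e == [set h; r'] | e == [set h; r'']] ->
      r' \in e /\ r \in e \/ h \in e /\ (r' \in e \/ r'' \in e).
    by case/or3P=> /eqP->; rewrite !set21 !set22; auto.
  apply/negP=> /P_e {}P_e.
  case/or3P: fan_e P_e => [/eqP->|/mapP[x xs ->]|/path_sub/subsetP se].
  - rewrite !in_set2 (negbTE r_r'') => -[[_]|[/pred2P[]//]].
    by rewrite orbF => /eqP rr; rewrite -rr in r'rs.
  - rewrite !in_set2 => -[[/pred2P[/esym//|dx]]|[_ []/pred2P[/esym//|dx]]].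
    + by rewrite dx in r's.
    + by rewrite dx in r's.
    + by rewrite dx in r''s.
  - by case=> [[/se/r'rs]|[/se/hrs]].
rewrite eP andTb; case/or3P: fan_e => ->; by rewrite ?orbT.
Qed.

End Fans.

(** * Pieces, independently of their orientation *)

Section Pieces.

Variables (T : finType) (S : graph T) (a b c d : T).

(** The disjunction is that of the two directions in which the middle spike can
    be identified with a rim edge of the central wheel. *)
Definition piece : Prop := odd_wheel_path S a b c d \/ odd_wheel_path S d c b a.

Definition piece_edges : {set {set T}} := E S :\: path4_edges a b c d.

Hypothesis pieceS : piece.

Lemma piece_path4 : path4_edges a b c d \subset E S.
Proof.
case: pieceS => /odd_wheel_path_fan[s [_ _ _ SP _]] //.
by rewrite -path4_edges_rev.
Qed.

Lemma piece_terminals_neq (f : T -> 'I_3) :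
    (forall e, e \in piece_edges -> bichromatic f e) ->
  [/\ f a != f c, f d != f b & f a != f d].
Proof.
case: pieceS => /odd_wheel_path_fan[s [_ [s_odd ds] _ _ SE]] fP.
  have fan_f : all (bichromatic f) (fan_edges b c d s).
    by apply/allP=> e; rewrite -SE => /fP.
  by have [] := fan_terminals_neq s_odd fan_f; rewrite ds [f b == _]eq_sym.
have fan_f : all (bichromatic f) (fan_edges c b a s).
  by apply/allP=> e; rewrite -SE path4_edges_rev => /fP.
have [] := fan_terminals_neq s_odd fan_f.
by rewrite ds [f a == f d]eq_sym [f a == f c]eq_sym.
Qed.

Lemma piece_coloring (ca cb cc cd : 'I_3) :
    ca != cc -> cd != cb -> ca != cd ->
  exists f : T -> 'I_3, [/\ f a = ca, f b = cb, f c = cc, f d = cd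
    & forall e, e \in piece_edges -> bichromatic f e].
Proof.
move=> ac db ad.
case: pieceS => /odd_wheel_path_fan[s [s_uniq [s_odd ds] _ _ SE]].
  have [f [fa fb fc fd /allP fP]] := fan_coloring s_uniq s_odd ac db ad.
  by exists f; split; rewrite -?ds // => e; rewrite SE => /fP.
rewrite eq_sym in ad.
have [f [fa fb fc fd /allP fP]] := fan_coloring s_uniq s_odd db ac ad.
exists f; split; rewrite -?ds // => e.
by rewrite /piece_edges -path4_edges_rev SE => /fP.
Qed.

Lemma piece_minus_edge_coloring (x y w : 'I_3) e :
    x != y -> w != x -> w != y -> e \in piece_edges ->
  exists f : T -> 'I_3,
    [/\ f b = x, f c = x, (f a, f d) \in [:: (y, y); (x, y); (y, x)]
      & forall e', e' \in piece_edges -> e' != e -> bichromatic f e'].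
Proof.
move=> xy wx wy.
case: pieceS => /odd_wheel_path_fan[s [s_uniq [s_odd ds] _ _ SE]] eS.
  have e_fan : e \in fan_edges b c d s by rewrite -SE.
  have [f [fb fc fad fP]] := fan_minus_edge_coloring xy wx wy s_uniq s_odd e_fan.
  by exists f; split; rewrite -?ds // => e'; rewrite SE => /fP.
have e_fan : e \in fan_edges c b a s by rewrite -SE path4_edges_rev.
have [f [fb fc fad fP]] := fan_minus_edge_coloring xy wx wy s_uniq s_odd e_fan.
exists f; split=> //; last first.
  by move=> e'; rewrite /piece_edges -path4_edges_rev SE => /fP.
move: fad; rewrite ds !inE !xpair_eqE.
by case/or3P=> /andP[-> ->]; rewrite ?orbT.
Qed.

Lemma piece_cover : V S \subset cover piece_edges.
Proof.
suff cov r r' h r'' : odd_wheel_path S r r' h r'' ->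
    V S \subset cover (E S :\: path4_edges r r' h r'').
  by case: pieceS => /cov //; rewrite path4_edges_rev.
case/odd_wheel_path_fan=> s [_ [s_odd ds] -> _ SE]; apply/subsetP=> x.
have coverE e t : e \in fan_edges r' h r'' s -> t \in e ->
    t \in cover (E S :\: path4_edges r r' h r'').
  by rewrite -SE => eS te; apply/bigcupP; exists e.
have rs : r \in s by rewrite -ds; case: (s) s_odd => //= t s' _; apply: mem_last.
have spike t : t \in s -> [set h; t] \in fan_edges r' h r'' s.
  by move=> ts; rewrite inE mem_cat (map_f (fun t => [set h; t])) // orbT.
rewrite inE !in_cons => /or4P[/eqP->|/eqP->|/eqP->|xs].
- exact: coverE _ _ (spike r rs) (set21 _ _).
- exact: coverE _ _ (mem_head _ _) (set21 _ _).
- exact: coverE _ _ (mem_head _ _) (set22 _ _).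
exact: coverE _ _ (spike x xs) (set22 _ _).
Qed.

End Pieces.

(** * Alternation around an odd cycle *)

Section OddCycle.

Variable q : nat.
Implicit Type i : 'I_(2 * q).+1.

Lemma next_enum_ord i : next (enum 'I_(2 * q).+1) i = ordS i.
Proof.
have idx : index (val i) (iota 0 (2 * q).+1) = i.
  by rewrite -val_enum_ord (index_map val_inj) index_enum_ord.
apply: val_inj; rewrite -(next_map val_inj) ?enum_uniq // val_enum_ord.
rewrite next_nth mem_iota /= ltn_ord; move: idx => /= ->.
have [lt_i|le_i] := ltnP i (2 * q).
  by rewrite nth_iota // modn_small.
have -> : (i : nat) = 2 * q by apply/eqP; rewrite eqn_leq le_i -ltnS ltn_ord.
by rewrite nth_default ?size_iota // modnn.
Qed.

Lemma odd_cycle_alternation (b : 'I_(2 * q).+1 -> bool) :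
  ~ forall i, b (ordS i) = ~~ b i.
Proof.
move=> bS.
have bE m (ltm : m < (2 * q).+1) : b (Ordinal ltm) = b ord0 (+) odd m.
  elim: m ltm => [|m IHm] ltm.
    by rewrite addbF; congr b; apply: val_inj.
  have -> : Ordinal ltm = ordS (Ordinal (ltnW ltm)).
    by apply: val_inj; rewrite /= modn_small.
  by rewrite bS IHm /= addbN.
have /esym := bS ord_max.
have -> : ordS (@ord_max (2 * q)) = ord0 by apply: val_inj; rewrite /= modnn.
have -> : @ord_max (2 * q) = Ordinal (ltnSn (2 * q)) by apply: val_inj.
by rewrite bE oddM addbF; case: (b ord0).
Qed.

(** Alternation around an odd cycle must have a defect, but a single one suffices
    and its place is free; all colorings of the multiwheel minus an edge are made
    from such an alternation, with the defect at the deleted edge. *)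
Lemma alternation_from i : exists p : 'I_(2 * q).+1 -> bool,
  [/\ p i = false, p (ordS i) = false & forall j, j != i -> p (ordS j) = ~~ p j].
Proof.
(* The parity of i + j alternates except from the last index to 0, where it
   repeats; flipping it behind i moves this repetition to i. *)
exists (fun j => odd (i + j) (+) (i < j)).
have ordSE (j : 'I_(2 * q).+1) : val (ordS j) = if j == ord_max then 0 else j.+1.
  have [->|jm] := eqVneq; first by rewrite /= modnn.
  have {}jm : (j : nat) != 2 * q by move: jm; rewrite -val_eqE.
  by rewrite /= modn_small // ltnS ltn_neqAle jm -ltnS ltn_ord.
split; rewrite ?ordSE.
- by rewrite addnn odd_double ltnn.
- case: eqP => [->|_]; first by rewrite addn0 oddM.
  by rewrite addnS /= addnn odd_double ltnSn.
move=> j; rewrite ordSE; case: (eqVneq j ord_max) => [->|jm] ji.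
  rewrite ltn0 addn0 addbF [i < _](_ : _ = true) ?addbT.
    by rewrite oddD oddM addbF negbK.
  have {}ji : (i : nat) != 2 * q by move: ji; rewrite -val_eqE /= eq_sym.
  by rewrite /= ltn_neqAle ji -ltnS ltn_ord.
have {}ji : (i == j :> nat) = false.
  by apply/negbTE; move: ji; rewrite -val_eqE /= eq_sym.
by rewrite addnS /= ltnS leq_eqVlt ji /= addNb.
Qed.

End OddCycle.
(** * Edges of the multiwheel *)

Section Multiwheel.

Variables (T : finType) (q : nat) (z : T).
Local Notation I := 'I_(2 * q).+1.
Variables (u v : I -> T) (S : I -> graph T) (C : graph T).

Hypothesis q_gt0 : 0 < q.
Hypothesis zuv_uniq : uniq (z :: codom u ++ codom v).
Hypothesis wheelC : is_wheel (2 * q).+1 z (codom u) C.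
Hypothesis pieceS : forall i, piece (S i) (v i) (u i) (u (ordS i)) (v (ordS i)).
Hypothesis S_C : forall i, V (S i) :&: V C = [set u i; u (ordS i)].
Hypothesis S_next :
  forall i, V (S i) :&: V (S (ordS i)) = [set u (ordS i); v (ordS i)].
Hypothesis S_disj : forall i j,
  j != i -> j != ordS i -> i != ordS j -> [disjoint V (S i) & V (S j)].

Local Notation G := (edge_sum (C :: codom S)).
Local Notation kept i := (piece_edges (S i) (v i) (u i) (u (ordS i)) (v (ordS i))).

Lemma neq_zu i : z != u i.
Proof.
move: zuv_uniq; rewrite cons_uniq mem_cat negb_or => /andP[/andP[zu _] _].
by apply: contraNneq zu => ->; apply: codom_f.
Qed.

Lemma neq_zv i : z != v i.
Proof.
move: zuv_uniq; rewrite cons_uniq mem_cat negb_or => /andP[/andP[_ zv] _].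
by apply: contraNneq zv => ->; apply: codom_f.
Qed.

Lemma neq_uv i j : u i != v j.
Proof.
move: zuv_uniq; rewrite cons_uniq cat_uniq => /and4P[_ _ /hasPn uv _].
by apply: contraNneq (uv _ (codom_f v j)) => <-; apply: codom_f.
Qed.

Lemma u_inj : injective u.
Proof.
apply/injectiveP; move: zuv_uniq.
by rewrite cons_uniq cat_uniq => /and4P[].
Qed.

Lemma ordS_neq (i : I) : ordS i != i.
Proof.
apply/eqP=> /(congr1 val) /= Si; have : i + 1 == i + 0 %[mod (2 * q).+1].
  by rewrite addn0 addn1 Si modn_small.
by rewrite eqn_modDl !modn_small // ltnS muln_gt0.
Qed.

Lemma ordS2_neq (i : I) : ordS (ordS i) != i.
Proof.
apply/eqP=> /(congr1 val) /=; rewrite -(addn1 (i.+1 %% _)) modnDml addn1 => SSi.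
have : i + 2 == i + 0 %[mod (2 * q).+1] by rewrite addn0 addn2 SSi modn_small.
by rewrite eqn_modDl !modn_small // ltnS -[2]/(2 * 1) leq_pmul2l.
Qed.

Lemma hub_center : z \in V C.
Proof. by case: wheelC => _ _ _ -> _; rewrite inE mem_head. Qed.

Lemma center_u i : u i \in V C.
Proof. by case: wheelC => _ _ _ -> _; rewrite !inE codom_f orbT. Qed.

Lemma center_edgeP e :
  reflect ((exists i, e = [set z; u i]) \/ exists i, e = [set u i; u (ordS i)])
          (e \in E C).
Proof.
case: wheelC => _ _ _ _ ->; rewrite inE.
have next_u i : next (codom u) (u i) = u (ordS i).
  by rewrite /codom /image_mem (next_map u_inj) ?enum_uniq // next_enum_ord.
apply: (iffP orP) => -[].
- by case/imsetP=> x /codomP[i ->] ->; left; exists i.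
- by case/imsetP=> x /codomP[i ->] ->; right; exists i; rewrite next_u.
- by case=> i ->; left; apply: (imset_f (fun x => [set z; x])); apply: codom_f.
case=> i ->; right; rewrite -next_u.
by apply: (imset_f (fun x => [set x; next (codom u) x])); apply: codom_f.
Qed.

Lemma hub_notin_piece i : z \notin V (S i).
Proof.
apply/negP=> zS; have : z \in V (S i) :&: V C by rewrite inE zS hub_center.
by rewrite S_C in_set2 (negbTE (neq_zu _)) (negbTE (neq_zu _)).
Qed.

Lemma u_in i : u i \in V (S i).
Proof. by have := set21 (u i) (u (ordS i)); rewrite -S_C inE => /andP[]. Qed.

Lemma u_inP l i : u l \in V (S i) -> l = i \/ l = ordS i.
Proof.
move=> uS; have : u l \in V (S i) :&: V C by rewrite inE uS center_u.
by rewrite S_C in_set2 => /pred2P[/u_inj|/u_inj]; [left|right].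
Qed.

(** The two ways in which the pieces i and j can be neighbors are merged into
    one: the common index l is the position of their common edge u_l v_l. *)
Lemma common_vertices i j x : i != j -> x \in V (S i) -> x \in V (S j) ->
  exists l, [/\ l = i \/ l = ordS i, l = j \/ l = ordS j
              & V (S i) :&: V (S j) = [set u l; v l]].
Proof.
rewrite eq_sym => ji xi xj; have [dj|jSi] := eqVneq j (ordS i).
  by exists j; split; [right | left | rewrite dj S_next].
have [di|iSj] := eqVneq i (ordS j).
  by exists i; split; [left | right | rewrite di setIC S_next].
by have /pred0P/(_ x) := S_disj ji jSi iSj; rewrite /= xi xj.
Qed.

Lemma edge_in_piece i e : e \in E (S i) -> #|e| = 2 /\ e \subset V (S i).
Proof. by have /forall_inP GS := graphP (S i) => /GS/andP[/eqP]. Qed.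

Lemma common_edge i j e : i != j -> e \in E (S i) -> e \in E (S j) ->
  exists2 l, l = i \/ l = ordS i & e = [set u l; v l].
Proof.
move=> ij /edge_in_piece[e2 /subsetP ei] /edge_in_piece[_ /subsetP ej].
have [x xe] : exists x, x \in e by apply/set0Pn; rewrite -card_gt0 e2.
have [l [li _ ij_l]] := common_vertices ij (ei x xe) (ej x xe).
exists l => //; apply/eqP; rewrite eqEcard e2 cards2; apply/andP; split.
  by apply/subsetP=> y ye; rewrite -ij_l inE ei ?ej.
by case: (_ != _).
Qed.

Lemma mem_edge_sum e :
  (e \in E G) = (e \in E C) (+) odd #|[set i | e \in E (S i)]|.
Proof.
rewrite inE /= oddD oddb; congr (_ (+) odd _).
by rewrite count_map enumT -size_filter cardE /enum_mem; congr (size _);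
   apply: eq_filter => i /=; rewrite inE.
Qed.

(** The edge lies in the two pieces that meet at l and in no other wheel. *)
Lemma uv_edge_annihilated l : [set u l; v l] \notin E G.
Proof.
rewrite mem_edge_sum.
have -> : ([set u l; v l] \in E C) = false.
  apply/center_edgeP => -[[i /set2_eq[]]|[i /set2_eq[]]] [].
  - by move=> zu; have := neq_zu l; rewrite zu eqxx.
  - by move=> _ vz; have := neq_zv l; rewrite vz eqxx.
  - by move=> _ vu; have := neq_uv (ordS i) l; rewrite vu eqxx.
  - by move=> _ vu; have := neq_uv i l; rewrite vu eqxx.
suff -> : [set i | [set u l; v l] \in E (S i)] = [set l; ord_pred l].
  by rewrite cards2; case: eqVneq => // /(congr1 (@ordS _)) /eqP;
     rewrite ord_predK (negbTE (ordS_neq l)).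
have path_sub i := subsetP (piece_path4 (pieceS i)).
apply/setP=> i; rewrite inE in_set2; apply/idP/pred2P=> [|[->|->]].
- case/edge_in_piece=> _ /subsetP/(_ _ (set21 _ _))/u_inP[->|->]; first by left.
  by right; rewrite ordSK.
- by apply: path_sub; rewrite !inE [[set u l; _]]setUC eqxx.
- by apply: path_sub; rewrite !inE ord_predK eqxx !orbT.
Qed.

(** The edge lies in the central wheel and in the piece i only; the cycle has at
    least three edges, so no other piece contains both of its ends. *)
Lemma rim_edge_annihilated i : [set u i; u (ordS i)] \notin E G.
Proof.
rewrite mem_edge_sum (_ : _ \in _ = true); last by apply/center_edgeP; right; exists i.
suff -> : [set j | [set u i; u (ordS i)] \in E (S j)] = [set i] by rewrite cards1.
apply/setP=> j; rewrite inE in_set1; apply/idP/eqP=> [|->]; last first.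
  by apply: (subsetP (piece_path4 (pieceS i))); rewrite !inE eqxx orbT.
case/edge_in_piece=> _ /subsetP sub.
have [di|di] := u_inP (sub _ (set21 _ _)); first by rewrite di.
have [dSi|/ordS_inj-> //] := u_inP (sub _ (set22 _ _)).
by have := ordS2_neq j; rewrite -di dSi eqxx.
Qed.

Lemma spoke_edge_kept i : [set z; u i] \in E G.
Proof.
rewrite mem_edge_sum (_ : _ \in _ = true); last by apply/center_edgeP; left; exists i.
suff -> : [set j | [set z; u i] \in E (S j)] = set0 by rewrite cards0.
apply/setP=> j; rewrite !inE; apply/negP.
by case/edge_in_piece=> _ /subsetP/(_ _ (set21 _ _)); apply/negP/hub_notin_piece.
Qed.

(** An edge of S_i that lies in another wheel joins two vertices that this wheel
    shares with S_i, and the only such edges are those of the chosen path. *)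
Lemma kept_edge i e : e \in kept i -> e \in E G.
Proof.
case/setDP=> eS eP; rewrite !inE !negb_or -andbA in eP.
case/and3P: eP => vu uu uv.
rewrite mem_edge_sum.
have -> : (e \in E C) = false.
  apply/center_edgeP=> -[] [j de]; have [e2 /subsetP sub] := edge_in_piece eS.
    by have /negP[] := hub_notin_piece i; apply: sub; rewrite de set21.
  have /negP[] := uu; rewrite eqEcard e2 cards2; apply/andP; split.
    apply/subsetP=> x xe; rewrite -S_C inE sub //=.
    by move: xe; rewrite de => /set2P[->|->]; apply: center_u.
  by case: (_ != _).
suff -> : [set j | e \in E (S j)] = [set i] by rewrite cards1.
apply/setP=> j; rewrite inE in_set1; apply/idP/eqP=> [eSj|-> //].
apply/eqP; apply: contraT => ji; rewrite eq_sym in ji.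
have [l li de] := common_edge ji eS eSj.
by case: li => dl; rewrite de dl ?eqxx // [[set v i; _]]setUC eqxx in vu uv.
Qed.

Lemma multiwheel_edgeP e :
  e \in E G -> (exists i, e = [set z; u i]) \/ exists i, e \in kept i.
Proof.
move=> eG; have [/center_edgeP[|[i de]]|eC] := boolP (e \in E C).
- by left.
- by rewrite de (negbTE (rim_edge_annihilated i)) in eG.
right; have [i eS] : exists i, e \in E (S i).
  move: (eG); rewrite mem_edge_sum (negbTE eC) /= => e_odd.
  have /set0Pn[i] : [set i | e \in E (S i)] != set0.
    by apply: contraTneq e_odd => ->; rewrite cards0.
  by rewrite inE; exists i.
exists i; rewrite in_setD eS andbT !inE !negb_or.
rewrite [[set v i; _]]setUC; apply/andP; split; first apply/andP; first split.
- by apply: contraTneq eG => ->; apply: uv_edge_annihilated.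
- by apply: contraTneq eG => ->; apply: rim_edge_annihilated.
- by apply: contraTneq eG => ->; apply: uv_edge_annihilated.
Qed.

Lemma multiwheel_cover : V G \subset cover (E G).
Proof.
have cov e x : e \in E G -> x \in e -> x \in cover (E G).
  by move=> eG xe; apply/bigcupP; exists e.
rewrite /= big_cons /codom big_image /=; apply/subsetP=> x /setUP[|/bigcupP[i _]].
  case: wheelC => _ _ _ -> _; rewrite inE in_cons.
  case/predU1P=> [->|/codomP[i ->]].
    exact: cov (spoke_edge_kept ord0) (set21 _ _).
  exact: cov (spoke_edge_kept i) (set22 _ _).
move/(subsetP (piece_cover (pieceS i)))=> /bigcupP[e /kept_edge eG].
exact: cov.
Qed.

(** * Colorings of the multiwheel *)

Lemma multiwheel_not_3colorable : ~~ colorable G 3.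
Proof.
apply/negP=> /colorableP[f fP].
have fS i := piece_terminals_neq (pieceS i) (fun e eS => fP e (kept_edge eS)).
have fz i : f z != f (u i) by rewrite -bichromatic_pair; apply/fP/spoke_edge_kept.
pose w i := if f (v i) == f z then f (u i) else f (v i).
have wz i : w i != f z by rewrite /w; case: ifPn => // _; rewrite eq_sym.
have wS i : w i != w (ordS i).
  have [vu uv vv] := fS i; rewrite /w; case: (eqVneq _ (f z)) => [vz|_].
    case: (eqVneq _ (f z)) => [vSz|_]; first by rewrite vz vSz eqxx in vv.
    by rewrite eq_sym.
  by case: (eqVneq _ (f z)).
have [a az _] := third_color (f z) (f z).
apply: (@odd_cycle_alternation q (fun i => a == w i)) => i.
exact: two_remaining_colors (wz i) (wz _) az (wS i).
Qed.

(** Two pieces share at most the vertices u_l and v_l of one position l, so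
    local colorings that follow common colors of the u_i and v_i are
    compatible. *)
Lemma glue_colorings (f : I -> T -> 'I_3) (cz : 'I_3) (cu cv : I -> 'I_3) :
    (forall i, [/\ f i (v i) = cv i, f i (u i) = cu i,
       f i (u (ordS i)) = cu (ordS i) & f i (v (ordS i)) = cv (ordS i)]) ->
  exists g : T -> 'I_3, g z = cz /\ forall i, {in V (S i), g =1 f i}.
Proof.
move=> fP; have f_at l i x : l = i \/ l = ordS i -> x \in [set u l; v l] ->
    f i x = if x == u l then cu l else cv l.
  have [fv fu fuS fvS] := fP i; move=> li /set2P[->|->]; rewrite ?eqxx.
    by case: li => ->.
  by rewrite eq_sym (negbTE (neq_uv l l)); case: li => ->.
exists (fun x => if [pick i | x \in V (S i)] is Some i then f i x else cz).
split=> [|i x xi]; case: pickP => [j|].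
- by rewrite (negbTE (hub_notin_piece j)).
- by [].
- move=> xj; have [-> //|ij] := eqVneq i j.
  have [l [li lj ij_l]] := common_vertices ij xi xj.
  have xl : x \in [set u l; v l] by rewrite -ij_l inE xi xj.
  by rewrite (f_at l i) ?(f_at l j).
by move/(_ i); rewrite xi.
Qed.

(** Here e0 is the deleted edge, a spike of the central wheel or an edge of a
    piece. *)
Lemma multiwheel_coloring e0 (cz : 'I_3) (cu cv : I -> 'I_3) :
    (forall i, [set z; u i] != e0 -> cz != cu i) ->
    (forall i, exists f : T -> 'I_3,
       [/\ f (v i) = cv i, f (u i) = cu i, f (u (ordS i)) = cu (ordS i)
         & f (v (ordS i)) = cv (ordS i)]
       /\ forall e, e \in kept i -> e != e0 -> bichromatic f e) ->
  exists g : T -> 'I_3, forall e, e \in E G -> e != e0 -> bichromatic g e.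
Proof.
move=> zu /fin_all_exists[f fP].
have [g [gz gS]] := glue_colorings cz (fun i => proj1 (fP i)).
exists g => e /multiwheel_edgeP[[i ->] /zu|[i ei]].
  rewrite bichromatic_pair gz (gS i) ?u_in //.
  by have [[_ -> _ _] _] := fP i.
move=> ee0; have /setDP[eS _] := ei; have [_ /subsetP sub] := edge_in_piece eS.
have [_ /(_ e ei ee0)] := fP i; rewrite /bichromatic.
by rewrite (@eq_in_imset _ _ g (f i)) // => x /sub; apply: gS.
Qed.

Let c0 : 'I_3 := @Ordinal 3 0 isT.
Let c1 : 'I_3 := @Ordinal 3 1 isT.
Let c2 : 'I_3 := @Ordinal 3 2 isT.

Lemma multiwheel_minus_spoke_coloring i0 : exists g : T -> 'I_3,
  forall e, e \in E G -> e != [set z; u i0] -> bichromatic g e.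
Proof.
have [p [pi pSi pS]] := alternation_from i0.
pose c j := if j == i0 then c0 else if p j then c1 else c2.
have cS i : c i != c (ordS i).
  rewrite /c; have [->|ii0] := eqVneq i i0.
    by rewrite (negbTE (ordS_neq i0)) pSi.
  by rewrite pS //; case: (ordS i == i0); case: (p i).
apply: (@multiwheel_coloring _ c0 c c) => i.
  by rewrite /c; case: (eqVneq i i0) => [->|_ _]; [rewrite eqxx | case: (p i)].
have cSV : c (ordS i) != c i by rewrite eq_sym.
have [f [fv fu fuS fvS fP]] := piece_coloring (pieceS i) (cS i) cSV (cS i).
by exists f; split=> // e /fP.
Qed.

Lemma multiwheel_minus_kept_coloring i0 e0 : e0 \in kept i0 ->
  exists g : T -> 'I_3, forall e, e \in E G -> e != e0 -> bichromatic g e.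
Proof.
move=> e0S; have [p [pi pSi pS]] := alternation_from i0.
have [f0 [f0u f0uS f0v f0P]] :=
  @piece_minus_edge_coloring _ _ _ _ _ _ (pieceS i0) c0 c1 c2 _ isT isT isT e0S.
(* Only the piece i0 loses an edge; in the others the colors cu and cv need to
   meet the three conditions of [piece_coloring]. *)
have build cz cu cv : (forall i, cz != cu i) ->
    [/\ f0 (v i0) = cv i0, cu i0 = c0, cu (ordS i0) = c0
      & f0 (v (ordS i0)) = cv (ordS i0)] ->
    (forall i, i != i0 -> [/\ cv i != cu (ordS i), cv (ordS i) != cu i
       & cv i != cv (ordS i)]) ->
  exists g : T -> 'I_3, forall e, e \in E G -> e != e0 -> bichromatic g e.
  move=> czu [cv0 cu0 cuS0 cvS0] cP.
  apply: (@multiwheel_coloring _ cz cu cv) => [i _|i]; first exact: czu.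
  have [->|ii0] := eqVneq i i0; first by exists f0; rewrite cu0 cuS0.
  have [ac db ad] := cP i ii0.
  have [f [fv fu fuS fvS fP]] := piece_coloring (pieceS i) ac db ad.
  by exists f; split=> // e /fP.
(* In the second case t is the position, i0 or its successor, of the exceptional
   vertex, which has color 1 although its u-neighbor has color 0. *)
have [[fv fvS]|[t [fv fvS]]] :
    (f0 (v i0) = c1 /\ f0 (v (ordS i0)) = c1) \/
    exists t, f0 (v i0) = (if i0 == t then c1 else c0) /\
      f0 (v (ordS i0)) = if ordS i0 == t then c1 else c0.
  move: f0v; rewrite !inE !xpair_eqE => /or3P[]/andP[/eqP-> /eqP->].
  - by left.
  - right; exists (ordS i0).
    by rewrite !eqxx eq_sym (negbTE (ordS_neq i0)).
  - by right; exists i0; rewrite !eqxx (negbTE (ordS_neq i0)).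
- apply: (build c1 (fun=> c0) (fun i => if p i then c2 else c1)) => // [|i ii0].
    by rewrite pi pSi.
  by rewrite pS //; case: (p i).
pose cu i := if p i then c2 else c0.
apply: (build c1 cu (fun i => if i == t then c1 else cu i)) => [i||i ii0].
- by rewrite /cu; case: (p i).
- by rewrite /cu fv fvS pi pSi.
have tS : ~~ ((i == t) && (ordS i == t)).
  by apply/andP=> -[/eqP-> /eqP dt]; have := ordS_neq t; rewrite dt eqxx.
rewrite /cu pS //; move: tS.
by case: (i == t); case: (ordS i == t) => //; case: (p i).
Qed.

Lemma multiwheel_4critical : four_critical G.
Proof.
apply: four_critical_by_edges multiwheel_not_3colorable multiwheel_cover _.
move=> e /multiwheel_edgeP[[i ->]|[i]]; [
  exact: multiwheel_minus_spoke_coloring | exact: multiwheel_minus_kept_coloring].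
Qed.

End Multiwheel.

Theorem theorem8 (T : finType) (G : graph T) :
  projective_plane_multiwheel G -> four_critical G.
Proof.
case=> q [z [u [v [S [C [q1 zuv wC SP [SC SS SD ->]]]]]]].
exact: (@multiwheel_4critical T q z u v S C).
Qed.
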